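(* For any $n\ge 1$, there exists a nonnegative, primitive, column-stochastic matrix $W\in\mathbb{R}^{n\times n}$ such that $\beta_\pi=\frac{\sqrt2}{2}$ but $\kappa_\pi=2^{n-1}$.
   Context: $W$ is column-stochastic if $\mathbb 1_n^\top W=\mathbb 1_n^\top$, where $\mathbb 1_n\in\mathbb{R}^n$ is the all-ones vector. For such a nonnegative primitive $W$, the equilibrium vector $\pi\in\mathbb{R}^n$ is the unique vector with positive entries satisfying $W\pi=\pi$ and $\mathbb 1_n^\top\pi=1$. For $A\in\mathbb{R}^{n\times n}$, $\|A\|_\pi:=\|\mathrm{diag}(\sqrt\pi)^{-1}A\,\mathrm{diag}(\sqrt\pi)\|_2$ (spectral norm, square root entrywise). $\beta_\pi:=\|W-\pi\mathbb 1_n^\top\|_\pi$ and $\kappa_\pi:=\max_i\pi_i/\min_i\pi_i$.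
   Formalization: The statement is for n ≥ 2 instead of n ≥ 1: for n = 1 the only column-stochastic matrix is W = (1), so π = (1), W − π1ᵀ = 0 and β_π = 0, not √2/2. *)

(* Defs.v *)
(* MathComp world; the real numbers are an arbitrary R : realType. *)
From HB Require Import structures.
From mathcomp Require Import all_boot all_order all_algebra.
From mathcomp Require Import all_classical all_reals.

Set Implicit Arguments.
Unset Strict Implicit.
Unset Printing Implicit Defensive.

Import Order.TTheory GRing.Theory Num.Theory.

Local Open Scope classical_set_scope.
Local Open Scope ring_scope.

Definition ones (R : realType) (n : nat) : 'cV[R]_n := const_mx 1.

Definition nonnegative_mx (R : realType) (n : nat) (W : 'M[R]_n) : Prop :=
  forall i j : 'I_n, 0 <= W i j.

(* The exponent must be positive: W ^+ 0 is the identity, which is entrywise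
   positive when n = 1, whatever W is. *)
Definition primitive_mx (R : realType) (n : nat) (W : 'M[R]_n) : Prop :=
  exists2 k : nat, (0 < k)%N & forall i j : 'I_n, 0 < (W ^+ k) i j.

Definition column_stochastic (R : realType) (n : nat) (W : 'M[R]_n) : Prop :=
  (ones R n)^T *m W = (ones R n)^T.

(* The product is the 1 x 1 matrix with entry the sum of the entries of pi. *)
Definition is_equilibrium (R : realType) (n : nat) (W : 'M[R]_n)
    (pi : 'cV[R]_n) : Prop :=
  [/\ forall i : 'I_n, 0 < pi i 0,
      W *m pi = pi
    & (ones R n)^T *m pi = 1%:M].

Definition norm2 (R : realType) (n : nat) (x : 'cV[R]_n) : R :=
  Num.sqrt (\sum_(i < n) x i 0 ^+ 2).

(* The spectral norm is the operator norm induced by the Euclidean norm, not the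
   library's norm `|A| on matrices, which is the entrywise maximum. *)
Definition spectral_norm (R : realType) (n : nat) (A : 'M[R]_n) : R :=
  sup [set norm2 (A *m x) | x in [set x : 'cV[R]_n | norm2 x <= 1]].

Definition diag_sqrt (R : realType) (n : nat) (pi : 'cV[R]_n) : 'M[R]_n :=
  diag_mx (map_mx Num.sqrt pi^T).

Definition norm_pi (R : realType) (n : nat) (pi : 'cV[R]_n) (A : 'M[R]_n) : R :=
  spectral_norm (invmx (diag_sqrt pi) *m A *m diag_sqrt pi).

Definition beta_pi (R : realType) (n : nat) (W : 'M[R]_n) (pi : 'cV[R]_n) : R :=
  norm_pi pi (W - pi *m (ones R n)^T).

(* For n > 0 the range is finite and nonempty, so sup and inf are the maximum
   and the minimum of the entries. *)
Definition kappa_pi (R : realType) (n : nat) (pi : 'cV[R]_n) : R :=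
  sup (range (fun i : 'I_n => pi i 0)) / inf (range (fun i : 'I_n => pi i 0)).

(* Main.v *)
Require Import Defs.
From mathcomp Require Import all_boot all_order all_algebra.
From mathcomp Require Import all_classical all_reals.
From mathcomp Require Import ring lra.

Import Order.TTheory GRing.Theory Num.Theory.

Local Open Scope ring_scope.

(** For any positive probability vector [p], the lazy rank-one matrix
    [W = c I + (1 - c) p 1^T] fixes [p], and conjugating [W - p 1^T] by
    [diag (sqrt p)] gives [c (I - q q^T)] with [q = sqrt p] a unit vector, that
    is [c] times an orthogonal projection, which is nonzero once the dimension
    exceeds one. Hence [beta_pi = c] whatever [p] is; take [c = sqrt 2 / 2] and
    [p] geometric with ratio 2. *)

Section SpectralNorm.
Context {R : realType} {n : nat}.
Implicit Types (x q : 'cV[R]_n) (A : 'M[R]_n).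

Lemma norm2E x : norm2 x = Num.sqrt ((x^T *m x) 0 0).
Proof.
by congr Num.sqrt; rewrite mxE; apply: eq_bigr => i _; rewrite mxE expr2.
Qed.

Lemma gram_ge0 {m : nat} (x : 'cV[R]_m) : 0 <= (x^T *m x) 0 0.
Proof. by rewrite mxE sumr_ge0 // => i _; rewrite mxE -expr2 sqr_ge0. Qed.

Lemma norm2Z (a : R) x : norm2 (a *: x) = `|a| * norm2 x.
Proof.
rewrite !norm2E [(_ *: _)^T]linearZ /= -scalemxAl -scalemxAr scalerA mxE -expr2.
by rewrite sqrtrM ?sqr_ge0// sqrtr_sqr.
Qed.

(** The bound makes [c] an upper bound over the whole unit ball, and the unit vector puts [c] in the
    set, so the supremum is a maximum. *)
Lemma spectral_norm_attained A (c : R) :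
  (forall x, norm2 (A *m x) <= c * norm2 x) ->
  (exists2 x, norm2 x = 1 & norm2 (A *m x) = c) -> spectral_norm A = c.
Proof.
move=> Ac [x x1 Axc].
have c0 : 0 <= c by rewrite -Axc sqrtr_ge0.
have ub : ubound [set norm2 (A *m y) | y in [set y | norm2 y <= 1]]%classic c.
  move=> _ [y /= y1 <-]; apply: le_trans (Ac y) _.
  by rewrite -[leRHS]mulr1 ler_wpM2l.
have Sc : [set norm2 (A *m y) | y in [set y | norm2 y <= 1]]%classic c.
  by exists x => //=; rewrite x1.
apply/eqP; rewrite eq_le; apply/andP; split.
  by apply: ge_sup ub; exists c.
by apply: ub_le_sup Sc; exists c.
Qed.

(** Pythagoras: for a unit vector [q], the squared norm of the projection of [x] is that of [x]
    minus the square of [q^T *m x]. *)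
Lemma norm2_proj_le q x : q^T *m q = 1%:M ->
  norm2 ((1%:M - q *m q^T) *m x) <= norm2 x.
Proof.
move=> qq; rewrite !norm2E; apply: ler_wsqrtr.
have -> : ((1%:M - q *m q^T) *m x)^T *m ((1%:M - q *m q^T) *m x) =
    x^T *m x - (q^T *m x)^T *m (q^T *m x).
  have -> : (1%:M - q *m q^T) *m x = x - q *m (q^T *m x).
    by rewrite mulmxBl mul1mx mulmxA.
  have xq : x^T *m q = (q^T *m x)^T by rewrite trmx_mul trmxK.
  rewrite [(_ - _)^T]linearB /= trmx_mul -xq mulmxBl !mulmxBr !mulmxA.
  by rewrite -(mulmxA (x^T *m q) q^T q) qq mulmx1 subrr subr0.
have subE (A B : 'M[R]_1) : (A - B) 0 0 = A 0 0 - B 0 0 by rewrite !mxE.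
by rewrite subE lerBlDr lerDl gram_ge0.
Qed.

End SpectralNorm.

Lemma exists_orthogonal_unit {R : realType} {n : nat} (q : 'cV[R]_n.+2) :
  (forall i, 0 < q i 0) -> exists2 x : 'cV[R]_n.+2, norm2 x = 1 & q^T *m x = 0.
Proof.
(* Rotate the first two coordinates of [q] by a right angle: [y] is [(q_1, - q_0, 0, ..., 0)],
   nonzero since [q_1 > 0]. *)
move=> q0; pose y : 'cV[R]_n.+2 :=
  q (lift ord0 ord0) 0 *: delta_mx 0 0 - q 0 0 *: delta_mx (lift ord0 ord0) 0.
have qy : q^T *m y = 0.
  apply/matrixP => i j; rewrite !ord1 mulmxBr -!scalemxAr -!colE !mxE.
  by rewrite mulrC subrr.
have y0 : 0 < norm2 y.
  rewrite sqrtr_gt0 big_ord_recl ltr_pwDl ?sumr_ge0// => [|i _]; last exact: sqr_ge0.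
  by rewrite !mxE /= mulr1 mulr0 subr0 exprn_gt0.
exists ((norm2 y)^-1 *: y); last by rewrite -scalemxAr qy scaler0.
by rewrite norm2Z ger0_norm ?invr_ge0 ?(ltW y0)// mulVf ?gt_eqF.
Qed.

Lemma spectral_norm_proj {R : realType} {n : nat} (c : R) (q : 'cV[R]_n.+2) :
  0 <= c -> (forall i, 0 < q i 0) -> q^T *m q = 1%:M ->
  spectral_norm (c *: (1%:M - q *m q^T)) = c.
Proof.
move=> c0 q0 qq; apply: spectral_norm_attained => [x|].
  by rewrite -scalemxAl norm2Z ger0_norm// ler_wpM2l// norm2_proj_le.
(* The projection fixes every vector orthogonal to [q], so such a unit vector attains the bound. *)
have [x x1 qx] := exists_orthogonal_unit q q0.
exists x => //; rewrite -scalemxAl norm2Z ger0_norm//.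
by rewrite mulmxBl mul1mx -mulmxA qx mulmx0 subr0 x1 mulr1.
Qed.

Section LazyRankOne.
Context {R : realType} {n : nat}.
Context (c : R) (p : 'cV[R]_n).
Context (c_ge0 : 0 <= c) (c_lt1 : c < 1).
Context (p_gt0 : forall i, 0 < p i 0) (p_sum1 : (ones R n)^T *m p = 1%:M).

(** For [0 <= c < 1], a Markov chain that stays put with probability [c] and otherwise redraws its
    state from [p]. *)
Definition lazy_mx : 'M[R]_n := c *: 1%:M + (1 - c) *: (p *m (ones R n)^T).

Lemma lazy_mx_gt0 i j : 0 < lazy_mx i j.
Proof.
rewrite !mxE big_ord1 !mxE mulr1 ltr_wpDl ?mulr_ge0 ?ler0n//.
by rewrite mulr_gt0 ?subr_gt0.
Qed.

Lemma lazy_mx_stochastic : column_stochastic lazy_mx.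
Proof.
rewrite /column_stochastic mulmxDr -!scalemxAr mulmx1 mulmxA p_sum1 mul1mx.
by rewrite -scalerDl addrC subrK scale1r.
Qed.

Lemma lazy_mx_mul (x : 'cV[R]_n) : (ones R n)^T *m x = 1%:M ->
  lazy_mx *m x = c *: x + (1 - c) *: p.
Proof. by move=> x1; rewrite mulmxDl -!scalemxAl mul1mx -mulmxA x1 mulmx1. Qed.

(** Uniqueness needs no Perron-Frobenius: on vectors of total mass 1 the fixed-point equation reads
    [(1 - c) *: (p - x) = 0], and [c < 1]. *)
Lemma lazy_mx_equilibrium : unique (is_equilibrium lazy_mx) p.
Proof.
split; first by split=> //; rewrite lazy_mx_mul// -scalerDl addrC subrK scale1r.
move=> x [_ + x1]; rewrite lazy_mx_mul// => Wx.
have /eqP : (1 - c) *: (p - x) = 0.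
  rewrite scalerBr (scalerBl _ _ x) scale1r opprB addrA (addrC _ (c *: x)).
  by rewrite Wx subrr.
by rewrite scaler_eq0 !subr_eq0 (gt_eqF c_lt1) => /eqP.
Qed.

Lemma diag_sqrt_unit : diag_sqrt p \in unitmx.
Proof.
rewrite unitmxE det_diag unitfE; apply/prodf_neq0 => i _.
by rewrite !mxE gt_eqF ?sqrtr_gt0.
Qed.

Lemma conj_diag_sqrt :
  invmx (diag_sqrt p) *m (lazy_mx - p *m (ones R n)^T) *m diag_sqrt p =
  c *: (1%:M - map_mx Num.sqrt p *m (map_mx Num.sqrt p)^T).
Proof.
set q := map_mx _ _; set D := diag_sqrt p.
(* From [D *m q = p] and [1^T *m D = q^T], conjugation by [D] turns [p *m 1^T] into the symmetric
   [q *m q^T]. *)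
have Dq : D *m q = p.
  apply/matrixP => i j; rewrite mul_diag_mx !mxE !ord1 -expr2.
  by rewrite sqr_sqrtr// ltW.
have oD : (ones R n)^T *m D = q^T.
  by apply/matrixP => i j; rewrite mul_mx_diag !mxE mul1r !ord1.
have -> : lazy_mx - p *m (ones R n)^T = c *: (1%:M - p *m (ones R n)^T).
  by rewrite /lazy_mx scalerBr scalerBl scale1r addrA addrAC addrK.
rewrite -scalemxAr -scalemxAl; congr (_ *: _).
rewrite mulmxBr mulmx1 mulmxBl mulVmx ?diag_sqrt_unit// -!mulmxA oD.
by rewrite -{1}Dq -!mulmxA mulKmx ?diag_sqrt_unit.
Qed.

End LazyRankOne.

Lemma beta_pi_lazy_mx {R : realType} {n : nat} (c : R) (p : 'cV[R]_n.+2) :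
  0 <= c -> (forall i, 0 < p i 0) -> (ones R n.+2)^T *m p = 1%:M ->
  beta_pi (lazy_mx c p) p = c.
Proof.
move=> c0 p0 p1; rewrite /beta_pi /norm_pi conj_diag_sqrt//.
apply: spectral_norm_proj => // [i|]; first by rewrite mxE sqrtr_gt0.
(* The squares of the entries of [q = sqrt p] are the entries of [p], so [q] is a unit vector
   because [p] sums to 1. *)
rewrite -p1; apply/matrixP => i j; rewrite !mxE; apply: eq_bigr => k _.
by rewrite !mxE !ord1 mul1r -expr2 sqr_sqrtr// ltW.
Qed.

Lemma kappa_pi_monotone {R : realType} {n : nat} (p : 'cV[R]_n.+1) :
  {homo (fun i => p i 0) : i j / (i <= j)%N >-> i <= j} ->
  kappa_pi p = p ord_max 0 / p ord0 0.
Proof.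
move=> p_mono; rewrite /kappa_pi; set S := (X in sup X).
have ubS : ubound S (p ord_max 0).
  by move=> _ [i _ <-]; apply: p_mono; rewrite -ltnS.
have lbS : lbound S (p ord0 0) by move=> _ [i _ <-]; exact: p_mono.
have maxS : S (p ord_max 0) by exists ord_max.
have minS : S (p ord0 0) by exists ord0.
congr (_ / _); apply/eqP; rewrite eq_le; apply/andP; split.
- by apply: ge_sup ubS; exists (p ord0 0).
- by apply: ub_le_sup maxS; exists (p ord_max 0).
- by apply: ge_inf minS; exists (p ord0 0).
- by apply: lb_le_inf lbS; exists (p ord0 0).
Qed.

(** The denominator is the sum of the powers [2 ^+ i] for [i < n], which makes this a probability
    vector for [n > 0]. *)
Definition geometric_col (R : realType) (n : nat) : 'cV[R]_n :=
  \col_(i < n) (2 ^+ i / (2 ^+ n - 1)).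

Section GeometricCol.
Context {R : realType} {n : nat}.

Lemma geometric_den_gt0 : 0 < 2 ^+ n.+1 - 1 :> R.
Proof. by rewrite subr_gt0 exprn_egt1 ?ltr1n. Qed.

Lemma geometric_col_gt0 i : 0 < geometric_col R n.+1 i 0.
Proof. by rewrite mxE divr_gt0 ?exprn_gt0 ?ltr0n ?geometric_den_gt0. Qed.

Lemma geometric_col_sum1 :
  (ones R n.+1)^T *m geometric_col R n.+1 = 1%:M.
Proof.
apply/matrixP => i j; rewrite !ord1 !mxE.
under eq_bigr do rewrite !mxE mul1r.
(* Inserting the factor [2 - 1] lets the geometric sum collapse to [2 ^+ n.+1 - 1]. *)
have two1 : (2 : R) - 1 = 1 by ring.
rewrite -mulr_suml -[X in X / _]mul1r -{1}two1 -subrX1 divff//.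
by rewrite gt_eqF ?geometric_den_gt0.
Qed.

Lemma kappa_pi_geometric_col : kappa_pi (geometric_col R n.+1) = 2 ^+ n.
Proof.
rewrite kappa_pi_monotone => [|i j ij]; rewrite !mxE.
  rewrite expr0 mul1r invrK divfK//.
  by rewrite gt_eqF ?geometric_den_gt0.
by rewrite ler_pM2r ?invr_gt0 ?geometric_den_gt0// ler_weXn2l ?ler1n.
Qed.

End GeometricCol.

Theorem proposition3 (R : realType) (n : nat) (hn : (1 < n)%N) :
  exists (W : 'M[R]_n) (pi : 'cV[R]_n),
    [/\ nonnegative_mx W, primitive_mx W & column_stochastic W] /\
    unique (is_equilibrium W) pi /\
    beta_pi W pi = Num.sqrt 2 / 2 /\
    kappa_pi pi = 2 ^+ (n - 1).
Proof.
(* In dimension 1 the only column-stochastic matrix is 1, whose [beta_pi] is 0; hence [n] is at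
   least 2. *)
case: n hn => [|[|n]]// _.
have c0 : 0 <= Num.sqrt 2 / 2 :> R by rewrite divr_ge0 ?sqrtr_ge0 ?ler0n.
have c1 : Num.sqrt 2 / 2 < 1 :> R.
  (* Write 2 as the square root of [2 ^+ 2] and compare under the root. *)
  rewrite ltr_pdivrMr ?ltr0n// mul1r -[ltRHS]ger0_norm ?ler0n// -sqrtr_sqr.
  by rewrite ltr_sqrt; lra.
have p0 := @geometric_col_gt0 R n.+1.
have p1 := @geometric_col_sum1 R n.+1.
pose W := lazy_mx (Num.sqrt 2 / 2) (geometric_col R n.+2).
have W0 i j : 0 < W i j by exact: lazy_mx_gt0.
exists W, (geometric_col R n.+2); split; [split|split; [|split]].
- by move=> i j; exact: ltW.
(* All entries of [W] are already positive, so the first power witnesses primitivity. *)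
- by exists 1%N => // i j; rewrite expr1.
- exact: lazy_mx_stochastic.
- exact: lazy_mx_equilibrium.
- exact: beta_pi_lazy_mx.
- by rewrite kappa_pi_geometric_col subn1.
Qed.
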